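(* Let $C,D\subseteq\mathbb{R}^n$ be convex sets with $C\cap D\neq\emptyset$. Then the joint supporting subspace of $C$ and $D$ satisfies $$T(C,D)=H_C(C\cap D)+H_D(C\cap D).$$
   Context: $A\pm B=\{a\pm b\mid a\in A,b\in B\}$; $\operatorname{Span}$ is the linear span. Faces: for $C\subseteq\mathbb{R}^n$ convex, a subset $F\subseteq C$ is a face of $C$ if for all $y,z\in C$, whenever the open segment $]y,z[ = [y,z]\setminus\{y,z\}$ meets $F$, both $y,z\in F$. For $S\subseteq C$, $F_C(S)$ denotes the smallest face of $C$ containing $S$; $F_C(x)=F_C(\{x\})$. For non-empty $S\subseteq C$, the supporting subspace of $C$ generated by $S$ is $H_C(S):=\operatorname{Span}(F_C(S)-F_C(S))$. The joint supporting subspace of convex $C,D\subseteq\mathbb{R}^n$ is $T(C,D):=\operatorname{Span}F_{C-D}(0)$. *)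

(* Defs.v *)
From mathcomp Require Import all_boot all_order all_algebra.
From mathcomp Require Import all_classical all_reals.

Set Implicit Arguments.
Unset Strict Implicit.
Unset Printing Implicit Defensive.

Import Order.TTheory GRing.Theory Num.Theory.

Local Open Scope classical_set_scope.
Local Open Scope ring_scope.

Section Definitions.
Context {R : realType} {E : lmodType R}.
Implicit Types (A B C D F S : set E) (x y z : E).

Definition addset A B : set E := [set a + b | a in A & b in B].

Definition diffset A B : set E := [set a - b | a in A & b in B].

Definition linear_span A : set E :=
  smallest [set V : set E | submod_closed (mem V)] A.

Definition closed_segment y z : set E :=
  [set (1 - t) *: y + t *: z | t in [set t : R | 0 <= t <= 1]].

(** Empty when [y = z]. *)
Definition open_segment y z : set E := closed_segment y z `\` [set y; z].

(** [F] itself need not be convex, but the face generated by a convex subset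
    of a convex [C] is. *)
Definition face C F : Prop :=
  F `<=` C /\
  forall y z, C y -> C z -> open_segment y z `&` F !=set0 -> F y /\ F z.

(** Meaningful for [S `<=` C], see [face_gen_face]; otherwise no face
    contains [S] and this is the whole space. *)
Definition face_gen C S : set E := smallest (face C) S.

Definition supporting_subspace C S : set E :=
  linear_span (diffset (face_gen C S) (face_gen C S)).

Definition joint_supporting_subspace C D : set E :=
  linear_span (face_gen (diffset C D) [set 0]).

Lemma linear_span_submod A : submod_closed (mem (linear_span A)).
Proof.
split=> [|a u v]; first by rewrite inE => V [/= [+ _] _]; rewrite inE.
rewrite !inE => Au Av V [/= [V0 VL] AV].
by have := VL a u v; rewrite !inE; apply; [exact: Au|exact: Av].
Qed.

Lemma face_gen_face C S : S `<=` C -> face C (face_gen C S).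
Proof.
move=> SC; split=> [x Fx|y z Cy Cz [w [yzw Fw]]].
  by apply: Fx; split=> //; split.
by split=> F [fF SF]; have [_ /(_ y z Cy Cz)[]] := fF => //;
  exists w; split=> //; exact: Fw.
Qed.

End Definitions.

(* Main.v *)
Require Import Defs.
From mathcomp Require Import all_boot all_order all_algebra.
From mathcomp Require Import all_classical all_reals convex.
From mathcomp Require Import interval_inference lra ring.

Import Order.TTheory GRing.Theory Num.Theory.

Local Open Scope classical_set_scope.
Local Open Scope ring_scope.

(** The faces involved have a concrete description: in a convex set [C], the
    face generated by [S] consists of those [x] of [C] from which a segment of
    [C] can be run through a point [s] of [S] and strictly beyond it
    ([face_genE]).  These points must all be there, since the face property
    applied to such a segment puts [x] in every face containing [s]; and they
    form a face: if a segment from [w] runs beyond [s], and one from [y] runs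
    beyond [w], an average of their far ends is the far end of a segment from
    [y] running beyond [s] ([prolongs_trans]).

    Read in [C - D] with [S = {0}], the description says that [c - d] lies in
    the face of [0] when [(1 - t) (c - d) + t (c' - d') = 0] for some
    [0 < t < 1], that is, when [(1 - t) c + t c' = (1 - t) d + t d'].  This
    common value is a point of [C] and of [D], and it shows at the same time
    that [c] is in the face of [C] and [d] in the face of [D] generated by
    [C `&` D] ([face_gen_diff_split]).  Both faces contain any given point [p]
    of [C `&` D], so [c - d = (c - p) + (p - d)] gives one inclusion.

    Conversely, if a segment of [C] runs from [x] through [s] in [C `&` D] to
    [u], subtracting [s], a point of [D], turns it into a segment of [C - D]
    from [x - s] through [0] to [u - s]; so [x - s] is in the face of [0].
    So is [s - r] for [s] and [r] in [C `&` D], its opposite being in [C - D]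
    too.  Hence the difference [(x - s) + (s - r) - (y - r)] of two points [x]
    and [y] of the face of [C] is in the span of the face of [0], and likewise
    for [D] ([supporting_subspace_subl], [supporting_subspace_subr]). *)

Section JointSupportingSubspace.
Set Implicit Arguments.
Unset Strict Implicit.

Context {R : realType} {E : lmodType R}.
Implicit Types (A C D F S : set E) (a b t : R) (c d r s u v x y z : E).

(** * Linear spans *)

Lemma sub_linear_span A : A `<=` linear_span A.
Proof. exact: sub_gen_smallest. Qed.

Lemma linear_span_lin A a u v :
  linear_span A u -> linear_span A v -> linear_span A (a *: u + v).
Proof.
move=> Au Av; have [_ /(_ a u v)] := linear_span_submod A.
by rewrite !inE; apply.
Qed.

Lemma linear_span0 A : linear_span A 0.
Proof. by have [+ _] := linear_span_submod A; rewrite inE. Qed.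

Lemma linear_spanD A u v :
  linear_span A u -> linear_span A v -> linear_span A (u + v).
Proof. by move=> Au Av; rewrite -[u]scale1r; exact: linear_span_lin. Qed.

Lemma linear_spanB A u v :
  linear_span A u -> linear_span A v -> linear_span A (u - v).
Proof.
by move=> Au Av; rewrite addrC -scaleN1r; exact: linear_span_lin.
Qed.

Lemma addset_linear_span_submod A D :
  GRing.submod_closed (mem (addset (linear_span A) (linear_span D))).
Proof.
split=> [|a u v]; rewrite !inE.
  by exists 0; [exact: linear_span0|exists 0; rewrite ?addr0//;
    exact: linear_span0].
move=> [u1 Au1 [u2 Du2 <-]] [v1 Av1 [v2 Dv2 <-]].
exists (a *: u1 + v1); first exact: linear_span_lin.
exists (a *: u2 + v2); first exact: linear_span_lin.
by rewrite scalerDr addrACA.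
Qed.

(** * The face generated by a subset of a convex set *)

Lemma convex_set_comb C x y t : convex_set C -> C x -> C y -> 0 <= t <= 1 ->
  C ((1 - t) *: x + t *: y).
Proof.
move=> cvxC Cx Cy t01.
have := cvxC y x (Itv01 (andP t01).1 (andP t01).2).
by rewrite !inE addrC; apply.
Qed.

Lemma convex_set_conic C x y a b : convex_set C -> C x -> C y ->
  0 < a -> 0 < b -> exists2 v, C v & a *: x + b *: y = (a + b) *: v.
Proof.
move=> cvxC Cx Cy a0 b0; have ab0 : 0 < a + b by rewrite addr_gt0.
exists ((1 - b / (a + b)) *: x + (b / (a + b)) *: y).
  apply: convex_set_comb => //; apply/andP; split; first by rewrite divr_ge0 ?ltW.
  by rewrite ler_pdivrMr// mul1r lerDr ltW.
rewrite scalerDr !scalerA; congr (_ *: _ + _ *: _); field; exact: lt0r_neq0.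
Qed.

(** The point [u] is the far end of a segment that starts at [x] and passes
    through [s].  Unlike in an open segment, [x = u = s] is accepted, so that
    every point of [C] prolongs to itself. *)
Definition prolongs C x s : Prop :=
  exists2 u, C u & exists2 t, 0 < t < 1 & s = (1 - t) *: x + t *: u.

(** This is what makes the set in [face_prolongs] a face.  With [u]
    the far end beyond [s] of the segment issued from the inner point, [s] is a
    combination of [y], [z] and [u] with positive weights; merging the last two
    into one point of [C] leaves a segment issued from [y]. *)
Lemma prolongs_trans C y z s t : convex_set C -> C z -> 0 < t < 1 ->
  prolongs C ((1 - t) *: y + t *: z) s -> prolongs C y s.
Proof.
move=> cvxC Cz /andP[t0 t1] [u Cu [a /andP[a0 a1] ->]].
have b0 : 0 < (1 - a) * t by rewrite mulr_gt0// subr_gt0.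
have [v Cv vE] := convex_set_conic cvxC Cz Cu b0 a0.
exists v => //; exists ((1 - a) * t + a).
  have : 0 < (1 - a) * (1 - t) by rewrite mulr_gt0// subr_gt0.
  by nra.
rewrite -vE scalerDr !scalerA -addrA; congr (_ *: _ + _); ring.
Qed.

Lemma open_segment_comb y z w :
  open_segment y z w -> exists2 t, 0 < t < 1 & w = (1 - t) *: y + t *: z.
Proof.
move=> [[t /= /andP[t0 t1] <-] /not_orP[wy wz]]; exists t => //.
rewrite !lt_neqAle t0 t1 !andbT; apply/andP; split; apply/eqP => te.
  by apply: wy; rewrite -te subr0 scale1r scale0r addr0.
by apply: wz; rewrite te subrr scale1r scale0r add0r.
Qed.

Lemma face_prolongs C S : convex_set C -> S `<=` C ->
  face C [set x | C x /\ exists2 s, S s & prolongs C x s].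
Proof.
move=> cvxC SC; split=> [x []//|y z Cy Cz [w [/open_segment_comb[t t01 wE]]]].
move=> [Cw [s Ss sw]]; split; split=> //; exists s => //.
  by apply: (@prolongs_trans _ _ z _ t) => //; rewrite -wE.
apply: (@prolongs_trans _ _ y _ (1 - t)) => //; first by move: t01; lra.
by rewrite subKr addrC -wE.
Qed.

Lemma sub_open_segment y z t :
  y != z -> 0 < t < 1 -> open_segment y z ((1 - t) *: y + t *: z).
Proof.
move=> yz /andP[t0 t1]; split; first by exists t => //=; rewrite !ltW.
have tN0 : t != 0 by rewrite gt_eqF.
have tN1 : 1 - t != 0 by rewrite subr_eq0 gt_eqF.
move=> [] /= /eqP; rewrite -subr_eq0.
  rewrite (_ : _ - y = t *: (z - y)).
    by rewrite scaler_eq0 (negPf tN0) subr_eq0 eq_sym (negPf yz).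
  by rewrite scalerBr scalerBl scale1r addrAC [y - _]addrC addrK addrC.
rewrite (_ : _ - z = (1 - t) *: (y - z)).
  by rewrite scaler_eq0 (negPf tN1) subr_eq0 (negPf yz).
by rewrite scalerBr -addrA; congr (_ + _); rewrite scalerBl scale1r opprB.
Qed.

(** The case [x = u] needs a separate argument, open segments between equal
    points being empty. *)
Lemma prolongs_face C F x s :
  face C F -> C x -> F s -> prolongs C x s -> F x.
Proof.
move=> [_ faceF] Cx Fs [u Cu [t t01 sE]].
have [xu|xu] := eqVneq x u.
  by move: Fs; rewrite sE -xu -scalerDl subrK scale1r.
apply: (proj1 (faceF x u Cx Cu _)); exists s; split=> //.
by rewrite sE; exact: sub_open_segment.
Qed.

Lemma face_genE C S : convex_set C -> S `<=` C ->
  face_gen C S = [set x | C x /\ exists2 s, S s & prolongs C x s].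
Proof.
move=> cvxC SC; apply/seteqP; split.
  apply: smallest_sub; first exact: face_prolongs.
  move=> s Ss; split; first exact: SC.
  exists s => //; exists s; first exact: SC.
  exists 2^-1; first by lra.
  by rewrite -scalerDl subrK scale1r.
move=> x [Cx [s Ss xs]] F [faceF SF].
by apply: (prolongs_face faceF Cx _ xs); exact: SF.
Qed.

(** * Joint supporting subspaces *)

Lemma convex_diffset C D :
  convex_set C -> convex_set D -> convex_set (diffset C D).
Proof.
move=> cvxC cvxD x y k; rewrite !inE.
move=> [c Cc [d Dd <-]] [c' Cc' [d' Dd' <-]].
have := cvxC c c' k; have := cvxD d d' k; rewrite !inE => cvxd cvxc.
eexists; first exact: cvxc Cc Cc'.
eexists; first exact: cvxd Dd Dd'.
by rewrite opprD addrACA -!scalerBr.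
Qed.

Lemma diffset0 C D : C `&` D !=set0 -> [set 0] `<=` diffset C D.
Proof. by move=> [p [Cp Dp]] _ ->; exists p => //; exists p; rewrite ?subrr. Qed.

(** One equation in [C - D] yields one point of [C `&` D] that plays a double
    role: it is inside a segment of [C] issued from [c] and, after moving terms
    across, inside a segment of [D] issued from [d]. *)
Lemma face_gen_diff_split C D x : convex_set C -> convex_set D ->
  C `&` D !=set0 -> face_gen (diffset C D) [set 0] x ->
  exists c d, [/\ face_gen C (C `&` D) c, face_gen D (C `&` D) d & x = c - d].
Proof.
move=> cvxC cvxD CD0; rewrite face_genE;
  [|exact: convex_diffset|exact: diffset0].
move=> [[c Cc [d Dd <-]] [_ -> [_ [c' Cc' [d' Dd' <-]] [t t01 E0]]]].
pose p := (1 - t) *: c + t *: c'.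
have pE : p = (1 - t) *: d + t *: d'.
  apply/eqP; rewrite -subr_eq0 E0 /p !scalerBr opprD.
  by rewrite addrACA.
have t01' : 0 <= t <= 1 by case/andP: t01 => *; rewrite !ltW.
have CDp : (C `&` D) p.
  by split; [|rewrite pE]; exact: convex_set_comb.
exists c, d; split=> //.
  rewrite face_genE//; split=> //; exists p => //.
  by exists c' => //; exists t.
rewrite face_genE//; split=> //; exists p => //.
by exists d' => //; exists t.
Qed.

Lemma mem_face_gen_diff C D c d c' d' t : convex_set C -> convex_set D ->
  C `&` D !=set0 -> C c -> D d -> C c' -> D d' -> 0 < t < 1 ->
  (1 - t) *: (c - d) + t *: (c' - d') = 0 ->
  face_gen (diffset C D) [set 0] (c - d).
Proof.
move=> cvxC cvxD CD0 Cc Dd Cc' Dd' t01 E0.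
rewrite face_genE; [|exact: convex_diffset|exact: diffset0].
split; first by exists c => //; exists d.
exists 0 => //; exists (c' - d'); first by exists c' => //; exists d'.
by exists t.
Qed.

Section Telescope.
Context {C D : set E} (cvxC : convex_set C) (cvxD : convex_set D).
Local Notation T := (joint_supporting_subspace C D).

(** The points [s - r] and [r - s] of [C - D] have midpoint [0]. *)
Lemma joint_supporting_inter s r :
  (C `&` D) s -> (C `&` D) r -> T (s - r).
Proof.
move=> [Cs Ds] [Cr Dr]; apply: sub_linear_span.
apply: (@mem_face_gen_diff _ _ s r r s 2^-1) => //; [by exists s|lra|].
have -> : 1 - 2^-1 = 2^-1 :> R by lra.
by rewrite -scalerDr addrC subrKA subrr scaler0.
Qed.

(** Translating by [- s] sends the segment of [C] witnessing [prolongs C x s] to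
    a segment of [C - D] through [0]. *)
Lemma joint_supporting_prolongsl x s :
  C x -> (C `&` D) s -> prolongs C x s -> T (x - s).
Proof.
move=> Cx [Cs Ds] [u Cu [t t01 sE]]; apply: sub_linear_span.
apply: (@mem_face_gen_diff _ _ x s u s t) => //; first by exists s.
rewrite !scalerBr addrACA -sE -opprD -scalerDl subrK scale1r.
exact: subrr.
Qed.

Lemma joint_supporting_prolongsr x s :
  D x -> (C `&` D) s -> prolongs D x s -> T (s - x).
Proof.
move=> Dx [Cs Ds] [u Du [t t01 sE]]; apply: sub_linear_span.
apply: (@mem_face_gen_diff _ _ s x s u t) => //; first by exists s.
rewrite !scalerBr addrACA -opprD -sE -scalerDl subrK scale1r.
exact: subrr.
Qed.

(** Two points of the face need not be linked to the same point of [C `&` D];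
    [s - r] makes up for the difference. *)
Lemma supporting_subspace_subl : supporting_subspace C (C `&` D) `<=` T.
Proof.
apply: smallest_sub; first exact: linear_span_submod.
move=> _ [x + [y + <-]]; rewrite (face_genE cvxC (@subIsetl _ _ _)).
move=> [Cx [s Ss xs]] [Cy [r Sr yr]].
have -> : x - y = (x - s) + (s - r) - (y - r) by rewrite subrKA opprB subrKA.
apply: linear_spanB; last exact: joint_supporting_prolongsl.
apply: linear_spanD; first exact: joint_supporting_prolongsl.
exact: joint_supporting_inter.
Qed.

Lemma supporting_subspace_subr : supporting_subspace D (C `&` D) `<=` T.
Proof.
apply: smallest_sub; first exact: linear_span_submod.
move=> _ [x + [y + <-]]; rewrite (face_genE cvxD (@subIsetr _ _ _)).
move=> [Dx [s Ss xs]] [Dy [r Sr yr]].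
have -> : x - y = (s - r) + (r - y) - (s - x).
  by rewrite subrKA opprB [RHS]addrC subrKA.
apply: linear_spanB; last exact: joint_supporting_prolongsr.
apply: linear_spanD; last exact: joint_supporting_prolongsr.
exact: joint_supporting_inter.
Qed.

End Telescope.

Lemma supporting_subspaceB C S x y :
  face_gen C S x -> face_gen C S y -> supporting_subspace C S (x - y).
Proof. by move=> Fx Fy; apply: sub_linear_span; exists x => //; exists y. Qed.

Lemma joint_supporting_subspaceE C D : convex_set C -> convex_set D ->
  C `&` D !=set0 ->
  joint_supporting_subspace C D =
  addset (supporting_subspace C (C `&` D)) (supporting_subspace D (C `&` D)).
Proof.
move=> cvxC cvxD CD0; apply/seteqP; split; last first.
  move=> _ [u Cu [v Dv <-]]; apply: linear_spanD.
    exact: supporting_subspace_subl Cu.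
  exact: supporting_subspace_subr Dv.
apply: smallest_sub; first exact: addset_linear_span_submod.
move=> x /face_gen_diff_split[]// c [d [Fc Fd ->]].
have [p Sp] := CD0.
have Sface A : face_gen A (C `&` D) p by exact: sub_gen_smallest.
exists (c - p); first exact: supporting_subspaceB.
by exists (p - d); [exact: supporting_subspaceB|rewrite subrKA].
Qed.

End JointSupportingSubspace.

Theorem theorem4p1 (R : realType) (n : nat) (C D : set 'rV[R]_n)
    (cvxC : convex_set C) (cvxD : convex_set D) (CD0 : C `&` D !=set0) :
  joint_supporting_subspace C D =
  addset (supporting_subspace C (C `&` D)) (supporting_subspace D (C `&` D)).
Proof. exact: joint_supporting_subspaceE. Qed.
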